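(* There is a function $f:\mathbb{Z}_{>0}\times\mathbb{Z}_{>0}\to\mathbb{Z}_{>0}$ such that the following holds. Let $k$ and $c$ be positive integers and let $G$ be a finite group with $s_k(G)\geq |G|-c$. Then $G$ contains a characteristic subgroup $N$ such that $G/N$ has exponent dividing $k$ and $|N|\leq f(c,k)$. Indeed, one may take $N=G^k$.
   Context: Let $G$ be a finite group and $k$ a positive integer. A subset $X\subseteq G$ is called $k$-power-avoiding if $\{g,g^k\}\not\subseteq X$ for every $g\in G$ (in particular, $X$ contains no element $g$ with $g^k=g$). Define $s_k(G)=\max\{|X| : X\subseteq G \text{ is } k\text{-power-avoiding}\}$. The subgroup $G^k$ is the subgroup of $G$ generated by all $k$th powers $g^k$, $g\in G$. *)

(* Defs.v *)
From mathcomp Require Import all_boot all_fingroup all_solvable.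

Set Implicit Arguments.
Unset Strict Implicit.
Unset Printing Implicit Defensive.

Local Open Scope group_scope.

Definition power_avoiding (gT : finGroupType) (k : nat) (G X : {set gT}) : bool :=
  (X \subset G) && [forall g in G, ~~ ([set g; g ^+ k] \subset X)].

(* set0 is always power-avoiding, so the maximum ranges over a nonempty family. *)
Definition max_avoiding (gT : finGroupType) (k : nat) (G : {set gT}) : nat :=
  \max_(X : {set gT} | power_avoiding k G X) #|X|.

Definition power_subgroup (gT : finGroupType) (k : nat) (G : {set gT}) : {group gT} :=
  <<[set g ^+ k | g in G]>>%G.

(* Main.v *)
(** If [X] is [k]-power-avoiding and [T = G \ X], then the [k]th power of an
    element outside [T] lies in [T]; hence the set [S] of [k]th powers has at
    most [2c] elements.  It is closed under conjugation and squaring, so, as in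
    Dietzmann's lemma, a word over [S] with two equal letters can be shortened:
    [x b x = x^2 b^x].  Hence every element of [G^k] is a product of [#|S|]
    elements of [S], and one may take [f c k = (2c)^(2c)]. *)

Require Import Defs.
From mathcomp Require Import all_boot all_fingroup all_solvable.

Set Implicit Arguments.
Unset Strict Implicit.
Unset Printing Implicit Defensive.

Local Open Scope group_scope.

Lemma not_uniq_split (T : eqType) (w : seq T) :
  ~~ uniq w -> exists a x b d, w = a ++ x :: b ++ x :: d.
Proof.
elim: w => //= x w IHw; rewrite negb_and negbK => /orP[|/IHw].
  by case/splitPr=> b d; exists [::], x, b, d.
by case=> a [y [b [d ->]]]; exists (x :: a), y, b, d.
Qed.

Section SquareConjClosed.

Variables (gT : finGroupType) (S : {set gT}).
Hypotheses (S1 : 1 \in S) (Ssqr : {in S, forall x, x * x \in S}).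
Hypothesis SJ : {in S &, forall x y, x ^ y \in S}.

(** Induction on the length: by pigeonhole, a word longer than [#|S|] repeats a letter, and merging
    the two occurrences saves one letter. *)
Lemma shorten_word (w : seq gT) : all (mem S) w ->
  exists w', [/\ all (mem S) w', size w' <= #|S|
               & \prod_(x <- w') x = \prod_(x <- w) x].
Proof.
have [n] := ubnP (size w); elim: n w => // n IHn w lt_w_n Sw.
have [le_w_S | lt_S_w] := leqP (size w) #|S|; first by exists w.
have /not_uniq_split[a [x [b [d def_w]]]] : ~~ uniq w.
  apply: contraL lt_S_w => /card_uniqP <-; rewrite -leqNgt.
  by apply/subset_leq_card/subsetP/allP.
move: Sw lt_w_n; rewrite {}def_w !(all_cat, size_cat) /= all_cat size_cat /=.
case/and4P=> Sa Sx Sb /andP[_ Sd] lt_w_n.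
(* The factor [x b x] becomes the single letter [x * x] followed by the conjugates by [x] of the
   letters of [b], all still in [S]. *)
have [||w' [Sw' le_w' def_w']] := IHn (a ++ x * x :: [seq y ^ x | y <- b] ++ d).
- by move: lt_w_n; rewrite !size_cat /= !size_cat size_map !addnS !ltnS.
- rewrite all_cat Sa /= all_cat Sd andbT Ssqr //=.
  by apply/allP=> _ /mapP[y /(allP Sb) Sy ->]; apply: SJ.
exists w'; split=> //; rewrite def_w' !(big_cat, big_cons) /= big_map.
congr (_ * _); rewrite -!mulgA; congr (_ * _).
have ->: \prod_(y <- b) y ^ x = (\prod_(y <- b) y) ^ x.
  by apply/esym/(big_morph (conjg^~ x)) => [y z|]; rewrite ?conjMg ?conj1g.
by rewrite !mulgA mulgV mul1g.
Qed.

Lemma card_gen_square_conj_closed : #|<<S>>| <= #|S| ^ #|S|.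
Proof.
rewrite -[X in (_ ^ X)%N]card_ord -card_ffun_on.
pose prod_word (c : {ffun 'I_#|S| -> gT}) := \prod_i c i.
apply: leq_trans (leq_imset_card prod_word _).
(* As the group is finite, generated elements are products of generators without inverses. *)
apply/subset_leq_card/subsetP=> _ /gen_prodgP[n [c Sc ->]].
have [|w [Sw le_w def_w]] := @shorten_word [seq c i | i <- index_enum 'I_n].
  by apply/allP=> _ /mapP[i _ ->]; apply: Sc.
(* Padding with [1], which lies in [S], gives exactly [#|S|] letters and keeps the product. *)
apply/imsetP; exists [ffun i : 'I_#|S| => nth 1 w i].
  apply/ffun_onP=> i; rewrite ffunE; have [lt_i | le_i] := ltnP i (size w).
    exact/(allP Sw)/mem_nth.
  by rewrite nth_default.
have <- : \prod_(x <- w) x = \prod_i c i by rewrite def_w big_map.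
rewrite /prod_word; under [RHS]eq_bigr do rewrite ffunE.
rewrite (big_nth 1) big_mkord (big_ord_widen _ (nth 1 w) le_w) big_mkcond /=.
by apply: eq_bigr => i _; case: ltnP => // le_i; rewrite nth_default.
Qed.

End SquareConjClosed.

Section PowerSubgroup.

Variables (gT : finGroupType) (k : nat) (G : {group gT}).

Let S : {set gT} := [set g ^+ k | g in G].

Lemma powers_sub : S \subset G.
Proof. by apply/subsetP=> _ /imsetP[g Gg ->]; apply: groupX. Qed.

(** An automorphism commutes with taking powers and maps [G] onto itself, so it permutes the
    generators. *)
Lemma power_subgroup_char : power_subgroup k G \char G.
Proof.
apply/charP; split=> [|f injf fG]; first by rewrite gen_subG powers_sub.
rewrite /= morphim_gen ?powers_sub //; congr <<_>>.
apply/setP=> x; apply/morphimP/imsetP=> [[_ _ /imsetP[g Gg ->] ->] | [y]].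
  by exists (f g); rewrite ?morphX // -{2}fG mem_morphim.
rewrite -{1}fG => /morphimP[g Gg _ ->] ->.
by exists (g ^+ k); [apply: groupX | apply: imset_f | rewrite morphX].
Qed.

Lemma exponent_quotient_power_subgroup : exponent (G / power_subgroup k G) %| k.
Proof.
apply/exponentP=> _ /morphimP[g Ng Gg ->].
by rewrite -morphX //; apply/coset_id/mem_gen/imset_f.
Qed.

Lemma card_power_subgroup : #|power_subgroup k G| <= #|S| ^ #|S|.
Proof.
apply: card_gen_square_conj_closed => [|_ /imsetP[g Gg ->]|].
- by apply/imsetP; exists 1; rewrite ?expg1n.
(* Since [g] commutes with itself, the square of [g ^+ k] is the [k]th power of [g * g]. *)
- by rewrite -expgMn //; apply: imset_f; rewrite groupM.
move=> _ y /imsetP[g Gg ->] /(subsetP powers_sub) Gy.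
by rewrite conjXg; apply: imset_f; rewrite groupJ.
Qed.

Lemma card_powers_avoiding (c : nat) :
  #|G| - c <= max_avoiding k G -> #|S| <= c.*2.
Proof.
rewrite /max_avoiding.
have [|X avX ->] := @eq_bigmax_cond _ [pred X | power_avoiding k G X]
  (fun X : {set gT} => #|X|).
  apply/card_gt0P; exists set0; rewrite inE /power_avoiding sub0set /=.
  apply/forall_inP=> g _; rewrite subset0; apply/set0Pn.
  by exists g; rewrite set21.
case/andP: avX => sXG /forall_inP avX le_X.
set T := G :\: X.
have le_T : #|T| <= c.
  by rewrite cardsD (setIidPr sXG) leq_subLR addnC -leq_subLR.
(* Both pieces have at most [c] elements: powers of elements of [X] land in [T], and the other
   powers come from [T]. *)
have sS : S \subset T :|: [set g ^+ k | g in T].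
  apply/subsetP=> _ /imsetP[g Gg ->]; rewrite inE.
  have [Xg | X'g] := boolP (g \in X); last first.
    by apply/orP; right; apply: imset_f; rewrite inE X'g.
  by have := avX g Gg; rewrite subUset !sub1set Xg /= !inE groupX // => ->.
apply: leq_trans (subset_leq_card sS) _.
apply: leq_trans (leq_card_setU _ _) _; rewrite -addnn leq_add //.
exact: leq_trans (leq_imset_card _ _) le_T.
Qed.

End PowerSubgroup.

Theorem theorem1 :
  exists f : nat -> nat -> nat,
    (forall c k : nat, 0 < c -> 0 < k -> 0 < f c k) /\
    (forall (k c : nat) (gT : finGroupType) (G : {group gT}),
       0 < k -> 0 < c -> #|G| - c <= max_avoiding k G ->
       (exists N : {group gT},
          [/\ N \char G, exponent (G / N) %| k & #|N| <= f c k]) /\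
       [/\ power_subgroup k G \char G,
           exponent (G / power_subgroup k G) %| k
         & #|power_subgroup k G| <= f c k]).
Proof.
exists (fun c _ => (c.*2 ^ c.*2)%N).
split=> [c k c_gt0 _ | k c gT G _ c_gt0 leG].
  by rewrite expn_gt0 double_gt0 c_gt0.
suff GkP : [/\ power_subgroup k G \char G,
             exponent (G / power_subgroup k G) %| k
           & #|power_subgroup k G| <= c.*2 ^ c.*2].
  by split=> //; exists (power_subgroup k G).
split; [exact: power_subgroup_char | exact: exponent_quotient_power_subgroup |].
apply: leq_trans (card_power_subgroup k G) _.
have:= card_powers_avoiding leG.
(* Zero is treated apart because raising the exponent to [c.*2] requires a positive base; the base
   is then raised as well. *)
case: #|_| => [|m] le_m; first by rewrite expn_gt0 double_gt0 c_gt0.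
by apply: leq_trans (leq_pexp2l _ le_m) _; rewrite ?leq_exp2r ?double_gt0.
Qed.
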